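(* Let $q$ be a prime power, $1\le l\le k$ and $t\ge 1$ integers, and let $f:\mathbb{F}_q^k\to\mathbb{F}_q^l$, $f(\mathbf{u})=\mathbf{F}\mathbf{u}$, be a linear function with $\mathbf{F}\in\mathbb{F}_q^{l\times k}$ of rank $l$. Then the optimal redundancy of an $(f,t)$-FCC satisfies $$ r_f(k,t)\ \ge\ \Big(\frac{q}{q-1}\Big)(2t+1)(1-q^{-l})-k+\frac{s}{(q-1)q^{k-1}},$$ where $s=\sum_{\mathbf{x}\in\ker(f)}w_H(\mathbf{x})$ is the sum of the Hamming weights of the vectors in $\ker(f)$.
   Context: $d_H$ and $w_H$ are Hamming distance and Hamming weight. An $(f,t)$-FCC of redundancy $r$ is a systematic encoding $\mathfrak{E}:\mathbb{F}_q^k\to\mathbb{F}_q^{k+r}$, $\mathfrak{E}(\mathbf{u})=(\mathbf{u},\mathbf{p}(\mathbf{u}))$ with $\mathbf{p}(\mathbf{u})\in\mathbb{F}_q^r$, such that $d_H(\mathfrak{E}(\mathbf{u}),\mathfrak{E}(\mathbf{u}'))\ge 2t+1$ whenever $f(\mathbf{u})\ne f(\mathbf{u}')$. The optimal redundancy $r_f(k,t)$ is the smallest $r$ for which an $(f,t)$-FCC of redundancy $r$ exists. *)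

(* Defs.v *)
From HB Require Import structures.
From mathcomp Require Import all_boot all_order all_algebra.

Set Implicit Arguments.
Unset Strict Implicit.
Unset Printing Implicit Defensive.

Import GRing.Theory.
Local Open Scope ring_scope.

Definition hamming_weight (K : finFieldType) (n : nat) (x : 'cV[K]_n) : nat :=
  #|[set i : 'I_n | x i 0 != 0]|.

Definition hamming_dist (K : finFieldType) (n : nat) (x y : 'cV[K]_n) : nat :=
  #|[set i : 'I_n | x i 0 != y i 0]|.

Definition systematic_encoding (K : finFieldType) (k r : nat)
    (p : 'cV[K]_k -> 'cV[K]_r) (u : 'cV[K]_k) : 'cV[K]_(k + r) :=
  col_mx u (p u).

Definition is_fcc (K : finFieldType) (T : eqType) (k r : nat)
    (f : 'cV[K]_k -> T) (t : nat) (p : 'cV[K]_k -> 'cV[K]_r) : bool :=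
  [forall u, forall v, (f u != f v) ==>
    (2 * t + 1 <= hamming_dist (systematic_encoding p u)
                               (systematic_encoding p v))%N].

Definition has_fcc (K : finFieldType) (T : eqType) (k : nat)
    (f : 'cV[K]_k -> T) (t r : nat) : bool :=
  [exists p : {ffun 'cV[K]_k -> 'cV[K]_r}, is_fcc f t p].

(* Repeating the message 2t+1 times as parity gives an FCC for every f. *)
Lemma has_fcc_exists (K : finFieldType) (T : eqType) (k : nat)
    (f : 'cV[K]_k -> T) (t : nat) : exists r : nat, has_fcc f t r.
Proof.
exists (k * (2 * t + 1))%N; apply/existsP.
pose p (u : 'cV[K]_k) := (mxvec (\matrix_(i < k, j < 2 * t + 1) u i 0))^T.
exists [ffun u => p u]; apply/forallP=> u; apply/forallP=> v; apply/implyP=> fuv.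
have [i uvi] : exists i, u i 0 != v i 0.
  apply/existsP; apply: contraNT fuv; rewrite negb_exists => /forallP uv.
  apply/eqP; congr f; apply/matrixP=> i j; rewrite ord1.
  by have := uv i; rewrite negbK => /eqP.
pose g (j : 'I_(2 * t + 1)) := rshift k (mxvec_index i j).
have g_inj : injective g.
  by move=> j1 j2 /rshift_inj/cast_ord_inj/enum_rank_inj[].
rewrite -[leqLHS]card_ord -(card_codom g_inj).
apply/subset_leq_card/subsetP=> _ /codomP[j ->].
by rewrite inE /systematic_encoding !col_mxEd !ffunE !mxE !mxvecE !mxE.
Qed.

Definition optimal_redundancy (K : finFieldType) (T : eqType) (k : nat)
    (f : 'cV[K]_k -> T) (t : nat) : nat :=
  ex_minn (has_fcc_exists f t).

(* Main.v *)
Require Import Defs.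
From HB Require Import structures.
From mathcomp Require Import all_boot all_order all_algebra.
From mathcomp Require Import mxabelem ring zify.
Import Order.TTheory GRing.Theory Num.Theory.
Local Open Scope ring_scope.

(** A Plotkin-type double count of the distances between codewords, over all
    ordered pairs of messages. Each of the k + r coordinates separates at most
    a fraction (q - 1) / q of the q^(2k) pairs. On the other hand, the
    q^(2k) (1 - q^-l) pairs with distinct values of f contribute at least
    2t + 1 each, and the pairs in a common fibre, which are the translates
    (u, u + x) with x in the kernel, already contribute q^k s through their
    systematic part. *)

(** Cauchy-Schwarz against the constant vector: sum [2ab <= a^2 + b^2] over all ordered pairs of
    indices. *)
Lemma sqr_sum_leq (I : finType) (n : I -> nat) :
  ((\sum_i n i) ^ 2 <= #|I| * \sum_i n i ^ 2)%N.
Proof.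
rewrite -(leq_pmul2l (isT : 0 < 2)%N).
have -> : (2 * (\sum_i n i) ^ 2 = \sum_i \sum_j 2 * (n i * n j))%N.
  rewrite expnS expn1 big_distrlr /= big_distrr /=.
  by apply: eq_bigr => i _; rewrite big_distrr.
have -> : (2 * (#|I| * \sum_i n i ^ 2) = \sum_i \sum_j (n i ^ 2 + n j ^ 2))%N.
  under [RHS]eq_bigr do rewrite big_split /= sum_nat_const.
  by rewrite big_split /= sum_nat_const -big_distrr /= addnn mul2n.
by apply: leq_sum => i _; apply: leq_sum => j _; apply: nat_Cauchy.
Qed.

(** With fibre sizes [n i], the agreeing pairs number [\sum_i n i ^ 2], which by [sqr_sum_leq] is at
    least a fraction [1 / #|I|] of all pairs. *)
Lemma sum_neq_leq (U I : finType) (g : U -> I) :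
  (#|I| * \sum_u \sum_v (g u != g v) <= #|I|.-1 * #|U| ^ 2)%N.
Proof.
pose n i := (\sum_u (g u == i))%N.
have nE : (\sum_i n i = #|U|)%N.
  rewrite exchange_big /= -sum1_card; apply: eq_bigr => u _.
  by rewrite (bigD1 (g u)) //= eqxx big1 // => i /negPf; rewrite eq_sym => ->.
have eqE : (\sum_u \sum_v (g u == g v) = \sum_i n i ^ 2)%N.
  transitivity (\sum_u n (g u))%N.
    apply: eq_bigr => u _; apply: eq_bigr => v _.
    by rewrite eq_sym.
  rewrite (partition_big g xpredT) //=; apply: eq_bigr => i _.
  rewrite (eq_bigr (fun=> n i)) => [|u /eqP-> //].
  by rewrite sum_nat_const -sum1_card big_mkcond -mulnn.
have sumE : (\sum_u \sum_v (g u != g v) + \sum_i n i ^ 2 = #|U| ^ 2)%N.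
  rewrite -eqE -big_split -mulnn -sum_nat_const; apply: eq_bigr => u _.
  rewrite -big_split -sum1_card; apply: eq_bigr => v _.
  by rewrite /=; case: (_ == _).
have := sqr_sum_leq _ n; rewrite nE -sumE.
by case: #|I| => [|m]; [rewrite !mul0n | rewrite /=; nia].
Qed.

Lemma hamming_distE (K : finFieldType) n (x y : 'cV[K]_n) :
  hamming_dist x y = (\sum_i (x i 0 != y i 0)%R)%N.
Proof.
rewrite /hamming_dist -sum1_card big_mkcond; apply: eq_bigr => i _.
by rewrite inE; case: (_ != _).
Qed.

Lemma sum_hamming_dist_leq (K : finFieldType) (U : finType) n
    (c : U -> 'cV[K]_n) :
  (#|K| * \sum_u \sum_v hamming_dist (c u) (c v) <= n * (#|K|.-1 * #|U| ^ 2))%N.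
Proof.
have -> : (\sum_u \sum_v hamming_dist (c u) (c v) =
           \sum_i \sum_u \sum_v (c u i 0 != c v i 0)%R)%N.
  rewrite [RHS]exchange_big; apply: eq_bigr => u _ /=.
  by rewrite [RHS]exchange_big; apply: eq_bigr => v _ /=; rewrite hamming_distE.
rewrite big_distrr -[X in (_ <= X * _)%N]card_ord -sum_nat_const.
by apply: leq_sum => i _; apply: (sum_neq_leq _ _ (fun u => c u i 0)).
Qed.

Lemma hamming_distDr (K : finFieldType) n (x y : 'cV[K]_n) :
  hamming_dist x (x + y) = hamming_weight y.
Proof.
rewrite /hamming_dist /hamming_weight; apply: eq_card => i.
by rewrite !inE mxE -[X in X != _]addr0 (inj_eq (addrI _)) eq_sym.
Qed.

Lemma leq_hamming_dist_systematic (K : finFieldType) k r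
    (p : 'cV[K]_k -> 'cV[K]_r) u v :
  (hamming_dist u v <=
   hamming_dist (systematic_encoding p u) (systematic_encoding p v))%N.
Proof.
rewrite !hamming_distE big_split_ord /=.
under [X in (_ <= X + _)%N]eq_bigr do rewrite !col_mxEu.
exact: leq_addr.
Qed.

(** [kermx] consists of row vectors, so the count goes through transposes, as the row space of
    [kermx A^T]. *)
Lemma card_mulmx_ker (K : finFieldType) l k (A : 'M[K]_(l, k)) :
  #|[set u : 'cV[K]_k | A *m u == 0]| = (#|K| ^ (k - \rank A))%N.
Proof.
rewrite -[\rank A]mxrank_tr -mxrank_ker -card_rowg.
rewrite -(card_imset _ (@trmx_inj _ _ _)); apply: eq_card => x.
rewrite mem_rowg sub_kermx; apply/imsetP/eqP => [[u + ->]|xA].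
  by rewrite inE => /eqP Au; rewrite -trmx_mul Au trmx0.
by exists x^T; rewrite ?trmxK // inE -[A]trmxK -trmx_mul xA trmx0.
Qed.

(** Translation by [u] maps the kernel onto the fibre through [u]. A general summand [F] serves both
    to count the fibre and to sum distances over it. *)
Lemma sum_same_fibre (K : finFieldType) l k (A : 'M[K]_(l, k))
    (F : 'cV[K]_k -> 'cV[K]_k -> nat) u :
  (\sum_(v | A *m u == A *m v) F u v =
   \sum_(x | (A *m x == 0)%R) F u (u + x)%R)%N.
Proof.
rewrite (reindex_inj (addrI u)); apply: eq_bigl => x.
by rewrite mulmxDr -[X in X == _]addr0 (inj_eq (addrI _)) eq_sym.
Qed.

Lemma linear_fcc_plotkin (K : finFieldType) (k l t r : nat) (A : 'M[K]_(l, k)) :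
  has_fcc (fun u : 'cV[K]_k => A *m u) t r ->
  (#|K| * ((2 * t + 1) * (#|K| ^ k - #|K| ^ (k - \rank A)) +
           \sum_(x : 'cV[K]_k | (A *m x == 0)%R) hamming_weight x)
   <= (k + r) * (#|K|.-1 * #|K| ^ k))%N.
Proof.
case/existsP=> p /forallP fccp.
have cardV : #|{: 'cV[K]_k}| = (#|K| ^ k)%N by rewrite card_mx muln1.
have N_gt0 : (0 < #|K| ^ k)%N by rewrite -cardV; apply/card_gt0P; exists 0.
(* The extra factor [#|K| ^ k] stands for the choice of the first message [u]; the remaining bound
   is then proved for each fixed [u]. *)
rewrite -(leq_pmul2r N_gt0).
have := sum_hamming_dist_leq K _ _ (systematic_encoding p).
rewrite cardV -mulnn => ub.
rewrite -!mulnA; apply: leq_trans ub; rewrite leq_mul2l; apply/orP; right.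
rewrite mulnC -[X in (X * _ <= _)%N]cardV -sum_nat_const; apply: leq_sum => u _.
rewrite [leqRHS](bigID (fun v => A *m u != A *m v)) /=; apply: leq_add.
  have -> : (#|K| ^ k - #|K| ^ (k - \rank A) =
             #|[pred v : 'cV[K]_k | A *m u != A *m v]|)%N.
    rewrite -card_mulmx_ker -cardV.
    rewrite -(cardC [pred v : 'cV[K]_k | A *m u == A *m v]).
    (* The fibre through [u] is as large as the kernel. *)
    have <- : #|[pred v : 'cV[K]_k | A *m u == A *m v]| =
              #|[set x : 'cV[K]_k | A *m x == 0]|.
      rewrite -!sum1_card; have := sum_same_fibre K l k A (fun _ _ => 1%N) u.
      by move=> ->; apply: eq_bigl => x; rewrite inE.
    by rewrite addKn; apply: eq_card.
  rewrite mulnC -sum_nat_const; apply: leq_sum => v Auv.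
  by have /forallP/(_ v)/implyP := fccp u; apply.
(* Inside the fibre the code guarantees no distance, so only the systematic part is kept: [u] and
   [u + x] differ in the support of [x]. *)
under [leqRHS]eq_bigl do rewrite negbK.
pose F u v := hamming_dist (systematic_encoding p u) (systematic_encoding p v).
rewrite (sum_same_fibre K l k A F u); apply: leq_sum => x _.
by rewrite -(hamming_distDr K _ u); apply: leq_hamming_dist_systematic.
Qed.

Theorem corollary5 (K : finFieldType) (k l t : nat) (A : 'M[K]_(l, k))
    (hl : (1 <= l)%N) (hlk : (l <= k)%N) (ht : (1 <= t)%N)
    (hA : \rank A = l) :
  let q : rat := #|K|%:R in
  let f : 'cV[K]_k -> 'cV[K]_l := fun u => A *m u in
  let s : nat := (\sum_(x : 'cV[K]_k | f x == 0%R) hamming_weight x)%N in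
  q / (q - 1) * (2 * t + 1)%:R * (1 - q ^- l) - k%:R
    + s%:R / ((q - 1) * q ^+ (k - 1))
  <= (optimal_redundancy f t)%:R.
Proof.
cbv zeta; set q : rat := #|K|%:R; set s := (\sum_(x | _) _)%N.
rewrite /optimal_redundancy; case: ex_minnP => r fccr _.
have := linear_fcc_plotkin K k l t r A fccr; rewrite -/s hA => le_nat.
have q_gt1 : 1 < q by rewrite ltr1n; exact: card_finNzRing_gt1.
have q_gt0 : 0 < q := lt_trans ltr01 q_gt1.
have K_gt0 : (0 < #|K|)%N by rewrite -(ltr_nat rat).
have le_rat : q * ((2 * t + 1)%:R * (q ^+ k - q ^+ (k - l)) + s%:R)
    <= (k + r)%:R * ((q - 1) * q ^+ k).
  (* Truncated subtractions cast correctly because [0 < #|K|] and [#|K| ^ (k - l) <= #|K| ^ k]. *)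
  move: le_nat; rewrite -subn1 -(ler_nat rat) !(natrM, natrD) !natrB //.
    by rewrite !natrX -/q.
  by rewrite leq_pexp2l // leq_subr.
have den_gt0 : 0 < (q - 1) * q ^+ k by rewrite mulr_gt0 ?subr_gt0 ?exprn_gt0.
move: le_rat; rewrite -ler_pdivrMr // (natrD _ k) -lerBlDl; apply: le_trans.
(* After division by [(q - 1) * q ^+ k] the claimed bound equals the one obtained, so a field
   identity remains. *)
rewrite le_eqVlt; apply/orP; left; apply/eqP.
have -> : q ^+ (k - l) = q ^+ k / q ^+ l.
  by rewrite expfB_cond ?gt_eqF.
(* The exponent [k - 1] is a genuine difference since [1 <= l <= k]. *)
have -> : q ^+ (k - 1) = q ^+ k / q.
  by rewrite expfB_cond ?gt_eqF // (leq_trans hl).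
have q_neq0 : q != 0 by rewrite gt_eqF.
have q1_neq0 : q - 1 != 0 by rewrite gt_eqF ?subr_gt0.
by field; rewrite q1_neq0 q_neq0 !expf_neq0.
Qed.
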